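(* Let $\mathbb{A}=(A_1,\dots,A_m)\in\mathbb{P}_n^m$ and $\omega=(w_1,\dots,w_m)\in\Delta_m$. If $X\in\Gamma(\omega;\mathbb{A})$ satisfies $X\le I$, then $$\operatorname{tr}X^{3}\le\operatorname{tr}\Omega(\omega;\mathbb{A}).$$
   Context: $\mathbb{P}_n$ is the set of $n\times n$ complex positive definite matrices; $\le$ is the Löwner order; $\Delta_m$ is the set of $\omega=(w_1,\dots,w_m)$ with $w_i>0$ and $\sum_i w_i=1$. $A\sharp B=A^{1/2}(A^{-1/2}BA^{-1/2})^{1/2}A^{1/2}$. The Karcher mean $\Lambda(\omega;A_1,\dots,A_m)$ is the unique $X\in\mathbb{P}_n$ with $\sum_i w_i\log(X^{-1/2}A_iX^{-1/2})=0$. Define $$\Gamma(\omega;\mathbb{A})=\{X\in\mathbb{P}_n:\Lambda(\omega;A_1\sharp X^{-1},\dots,A_m\sharp X^{-1})=I\},$$ equivalently the set of $X\in\mathbb{P}_n$ with $\sum_i w_i\log(A_i\sharp X^{-1})=0$. The Wasserstein mean $\Omega(\omega;\mathbb{A})$ is the unique minimizer over $X\in\mathbb{P}_n$ of $\sum_{i=1}^m w_i d_W^2(X,A_i)$, where $d_W(A,B)=[\operatorname{tr}(A+B-2(A^{1/2}BA^{1/2})^{1/2})]^{1/2}$; equivalently, it is the unique $X\in\mathbb{P}_n$ with $X=\sum_{i=1}^m w_i(X^{1/2}A_iX^{1/2})^{1/2}$. *)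

(* Defs.v *)
From mathcomp Require Import all_boot all_order all_algebra.
From mathcomp Require Import complex.
From mathcomp Require Import all_classical all_reals all_analysis.

Set Implicit Arguments.
Unset Strict Implicit.
Unset Printing Implicit Defensive.

Import Order.TTheory GRing.Theory Num.Theory.

Local Open Scope classical_set_scope.
Local Open Scope ring_scope.
Local Open Scope sesquilinear_scope.
Local Open Scope complex_scope.

(* Complex numbers are [R[i]] for [R : realType]; in the order on [R[i]],
   [z <= z'] means that [z' - z] is a nonnegative real number. *)

Section PositiveMatrices.
Variables (R : realType) (n : nat).
Implicit Types A B X : 'M[R[i]]_n.

Definition possemidef A : Prop :=
  A \is hermsymmx /\ forall v : 'cV[R[i]]_n, 0 <= (v^t* *m A *m v) 0 0.

Definition posdef A : Prop :=
  A \is hermsymmx /\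
  forall v : 'cV[R[i]]_n, v != 0 -> 0 < (v^t* *m A *m v) 0 0.

Definition loewner_le A B : Prop := possemidef (B - A).

(* Spectral functional calculus: for Hermitian [A], [spectralmx A] is unitary,
   [spectral_diag A] has real entries, and
   [A = invmx (spectralmx A) *m diag_mx (spectral_diag A) *m spectralmx A]. *)
Definition mxfun (f : R -> R) A : 'M[R[i]]_n :=
  invmx (spectralmx A)
  *m diag_mx (map_mx (fun z => (f (complex.Re z))%:C) (spectral_diag A))
  *m spectralmx A.

Definition sqrtmx A := mxfun Num.sqrt A.
Definition logmx A := mxfun (@ln R) A.

Definition geomean A B : 'M[R[i]]_n :=
  let S := sqrtmx A in
  S *m sqrtmx (invmx S *m B *m invmx S) *m S.

Definition dW A B : R[i] :=
  sqrtC (\tr (A + B - 2 *: sqrtmx (sqrtmx A *m B *m sqrtmx A))).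

End PositiveMatrices.

Section Means.
Variables (R : realType) (n m : nat).
Implicit Types (w : 'I_m -> R) (A : 'I_m -> 'M[R[i]]_n) (X : 'M[R[i]]_n).

Definition weights w : Prop := (forall i, 0 < w i) /\ \sum_i w i = 1.

(* Each mean is given by the property that determines it uniquely:
   [is_karcher_mean w A X] reads [X = Lambda(w; A)] and
   [is_wasserstein_mean w A X] reads [X = Omega(w; A)]. *)
Definition is_karcher_mean w A X : Prop :=
  posdef X /\
  \sum_i (w i)%:C *: logmx (invmx (sqrtmx X) *m A i *m invmx (sqrtmx X)) = 0.

Definition Gamma w A : set 'M[R[i]]_n :=
  [set X | posdef X /\
           is_karcher_mean w (fun i => geomean (A i) (invmx X)) 1%:M].

Definition wasserstein_cost w A X : R[i] := \sum_i (w i)%:C * dW X (A i) ^+ 2.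

Definition is_wasserstein_mean w A X : Prop :=
  posdef X /\
  forall Y, posdef Y -> wasserstein_cost w A X <= wasserstein_cost w A Y.

End Means.

(* Main.v *)
Require Import Defs.
From mathcomp Require Import all_boot all_order all_algebra.
From mathcomp Require Import complex.
From mathcomp Require Import all_classical all_reals all_analysis.
From mathcomp Require Import ring lra.

Import Order.TTheory GRing.Theory Num.Theory.

Local Open Scope ring_scope.

(** The proof goes through [\tr X]: first [\tr (X ^+ 3) <= \tr X], because the
    eigenvalues of [X] are positive and at most 1, then [\tr X <= \tr W].

    Write F(Y, A) for the fidelity [\tr (Y^(1/2) A Y^(1/2))^(1/2)].  Expanding
    the squared Bures-Wasserstein distance, the cost that [W] minimizes is
    [\tr Y - 2 * \sum_i w_i F(Y, A_i)] up to a constant.  Both terms are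
    homogeneous in [Y], of degrees 1 and 1/2, so comparing [W] with its positive
    multiples yields [\sum_i w_i F(W, A_i) <= \tr W]: the minimum is at least
    [- \tr W] ([mean_fidelity_le_mxtrace]).  Hence every positive definite [Y]
    gives a lower bound [2 * \sum_i w_i F(Y, A_i) - \tr Y <= \tr W]
    ([mxtrace_mean_ge]).

    Apply this to [Y = X].  The geometric mean [G_i] of [A_i] and [X^-1] solves
    the Riccati equation [G_i X G_i = A_i] ([geomean_riccati]); therefore
    [X^(1/2) A_i X^(1/2)] is the square of [X^(1/2) G_i X^(1/2)] and
    [F(X, A_i) = \tr (X G_i)] ([fidelity_sandwich]).  Since [log y <= y - 1]
    and [\sum_i w_i log G_i = 0], the weighted sum of the [\tr (X G_i)] is at
    least [\tr X] ([Gamma_mean_fidelity]), and the lower bound becomes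
    [2 * \tr X - \tr X].

    Roots and logarithms are computed through one observation, [unidiag_map]:
    the result of applying a function to the eigenvalues does not depend on the
    chosen unitary diagonalization, so any diagonalization at hand computes
    [mxfun]. *)

(** * Unitary diagonalization and functional calculus *)

Section UnitaryDiagonalization.
Local Open Scope sesquilinear_scope.
Set Implicit Arguments.
Unset Strict Implicit.

Variables (C : numClosedFieldType) (n : nat).
Implicit Types (A B X U T : 'M[C]_n) (d e : 'rV[C]_n).

Lemma hermsymmxP A : reflect (A^t* = A) (A \is hermsymmx).
Proof.
by apply: (iffP (is_hermitianmxP _ _ _)); rewrite expr0 scale1r => /esym.
Qed.

Lemma trmxC_mul m p q (A : 'M[C]_(m, p)) (B : 'M[C]_(p, q)) :
  (A *m B)^t* = B^t* *m A^t*.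
Proof. by rewrite trmx_mul map_mxM. Qed.

Lemma trmxC_inv A : (invmx A)^t* = invmx (A^t*).
Proof. by rewrite trmx_inv map_invmx. Qed.

Definition unidiag U d : 'M[C]_n := U^t* *m diag_mx d *m U.

Lemma unidiagM U d e : U \is unitarymx ->
  unidiag U d *m unidiag U e = unidiag U (\row_k (d 0 k * e 0 k)).
Proof.
move=> uU; rewrite /unidiag !mulmxA mulmxtVK//.
by rewrite -[U^t* *m diag_mx _ *m _]mulmxA mulmx_diag.
Qed.

Lemma unidiagB U d e : unidiag U d - unidiag U e = unidiag U (d - e).
Proof. by rewrite /unidiag -mulmxBl -mulmxBr -raddfB. Qed.

Lemma unidiag1 U : U \is unitarymx -> unidiag U (const_mx 1) = 1%:M.
Proof.
move=> uU; rewrite /unidiag diag_const_mx mulmx1 -invmx_unitary//.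
by rewrite mulVmx ?unitarymx_unit.
Qed.

Lemma unidiag_conj U d : U \is unitarymx ->
  U *m unidiag U d *m U^t* = diag_mx d.
Proof.
by move=> uU; rewrite /unidiag mulmxA mulmxtVK// mulmxA (unitarymxP uU) mul1mx.
Qed.

Lemma unidiag_herm U d : d \is a realmx -> unidiag U d \is hermsymmx.
Proof.
move=> dr; apply/hermsymmxP; rewrite /unidiag !trmxC_mul trmxCK mulmxA.
by rewrite tr_diag_mx map_diag_mx (realmxC dr).
Qed.

Lemma unidiag_unit U d : U \is unitarymx -> (forall k, d 0 k != 0) ->
  unidiag U d \in unitmx.
Proof.
move=> uU d0; pose e := \row_k (d 0 k)^-1.
have /mulmx1_unit[] // : unidiag U d *m unidiag U e = 1%:M.
rewrite unidiagM// -(unidiag1 uU); congr unidiag.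
by apply/rowP => k; rewrite !mxE divff.
Qed.

(** Entrywise, the hypothesis says that [P i j] vanishes unless
    [d 0 i = e 0 j], a condition that survives applying [g] to both rows. *)
Lemma diag_intertwine (g : C -> C) P d e :
  diag_mx d *m P = P *m diag_mx e ->
  diag_mx (map_mx g d) *m P = P *m diag_mx (map_mx g e).
Proof.
move=> dPe; apply/matrixP => i j; move/matrixP: dPe => /(_ i j).
rewrite !mul_diag_mx !mul_mx_diag !mxE.
have [->|P0] := eqVneq (P i j) 0; first by rewrite !mulr0 !mul0r.
by rewrite [RHS]mulrC => /(mulIf P0) ->; rewrite mulrC.
Qed.

(** The change of basis [V *m U^t*] intertwines the two diagonal matrices, hence
    also their images under [g]. *)
Lemma unidiag_map (g : C -> C) U V d e :
  U \is unitarymx -> V \is unitarymx -> unidiag U d = unidiag V e ->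
  unidiag U (map_mx g d) = unidiag V (map_mx g e).
Proof.
move=> uU uV UV; pose P := V *m U^t*.
have uV1 : V^t* *m V = 1%:M.
  by rewrite -invmx_unitary// mulVmx// unitarymx_unit.
have PU : P *m U = V by rewrite /P mulmxKtV.
have : diag_mx e *m P = P *m diag_mx d.
  move/(congr1 (fun M => V *m (M *m U^t*))): UV.
  rewrite /unidiag mulmxtVK// !mulmxA (unitarymxP uV) mul1mx => <-.
  by rewrite -!mulmxA.
move=> /(diag_intertwine g) eP.
rewrite /unidiag -[X in _ = _ *m X]PU mulmxA -(mulmxA _ _ P) eP.
by rewrite !mulmxA uV1 mul1mx.
Qed.

(** The diagonal entries of [U *m X *m U^t*] are the values of the quadratic
    form of [X] on the eigenvectors: this turns trace inequalities against a
    positive [X] into scalar inequalities between eigenvalues. *)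
Lemma mxtrace_mul_unidiag U X d :
  \tr (X *m unidiag U d) = \sum_k d 0 k * (U *m X *m U^t*) k k.
Proof.
rewrite /unidiag !mulmxA mxtrace_mulC !mulmxA mxtrace_mulC.
by apply: eq_bigr => k _; rewrite mul_diag_mx mxE.
Qed.

Lemma ler_mxtrace_mul_unidiag U X d e :
    (forall k, 0 <= (U *m X *m U^t*) k k) -> (forall k, d 0 k <= e 0 k) ->
  \tr (X *m unidiag U d) <= \tr (X *m unidiag U e).
Proof.
move=> X0 de; rewrite !mxtrace_mul_unidiag.
by apply: ler_sum => k _; rewrite ler_wpM2r.
Qed.

Lemma conj_diagE U B k :
  (U *m B *m U^t*) k k = ((row k U)^t*^t* *m B *m (row k U)^t*) 0 0.
Proof.
by rewrite trmxCK -row_mul !mxE; apply: eq_bigr => j _; rewrite !mxE.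
Qed.

Lemma row_trmxC_neq0 U k : U \in unitmx -> (row k U)^t* != 0.
Proof.
move=> uU; apply/eqP => /(congr1 (fun M : 'cV__ => M^t*)).
rewrite trmxCK trmx0 map_mx0 => r0.
have : row k (1%:M : 'M[C]_n) = 0 by rewrite -(mulmxV uU) row_mul r0 mul0mx.
by move/rowP/(_ k)/eqP; rewrite !mxE eqxx oner_eq0.
Qed.

Lemma diag_form_gt0 d (v : 'cV[C]_n) : (forall k, 0 < d 0 k) -> v != 0 ->
  0 < (v^t* *m diag_mx d *m v) 0 0.
Proof.
move=> d0 v0; rewrite mxE.
have E k : (v^t* *m diag_mx d) 0 k * v k 0 = d 0 k * `|v k 0| ^+ 2.
  by rewrite mul_mx_diag !mxE normCK; ring.
have t0 k : true -> 0 <= (v^t* *m diag_mx d) 0 k * v k 0.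
  by rewrite E mulr_ge0 ?exprn_ge0// ltW.
rewrite lt_neqAle sumr_ge0// andbT eq_sym psumr_neq0//.
have [k vk] : exists k, v k 0 != 0.
  apply/existsP; apply: contraNT v0 => /existsPn v0; apply/eqP/colP => k.
  by rewrite mxE; apply/eqP; rewrite -[_ == _]negbK v0.
apply/hasP; exists k; rewrite ?mem_index_enum//= E.
by rewrite mulr_gt0// exprn_gt0// normr_gt0.
Qed.

End UnitaryDiagonalization.

(** * Positive definite matrices, square roots and fidelity *)

Section PositiveDefinite.
Local Open Scope sesquilinear_scope.
Local Open Scope complex_scope.
Set Implicit Arguments.
Unset Strict Implicit.

Variables (R : realType) (n : nat).
Implicit Types (A B X Y U T S : 'M[R[i]]_n) (d e : 'I_n -> R) (s : R).

Definition realrow d : 'rV[R[i]]_n := \row_k (d k)%:C.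

Lemma realrow_real d : realrow d \is a realmx.
Proof. by apply/mxOverP => i k; rewrite mxE complex_real. Qed.

Lemma unidiag_realrowM U d e : U \is unitarymx ->
  unidiag U (realrow d) *m unidiag U (realrow e)
  = unidiag U (realrow (fun k => d k * e k)).
Proof.
move=> uU; rewrite (unidiagM _ _ uU).
suff -> : realrow (fun k => d k * e k)
        = \row_k (realrow d 0 k * realrow e 0 k) by [].
by apply/rowP => k; rewrite !mxE rmorphM.
Qed.

(** [mxfun] is defined through one particular diagonalization; [unidiag_map]
    allows any other. *)
Lemma mxfun_unidiag (f : R -> R) U d : U \is unitarymx ->
  mxfun f (unidiag U (realrow d)) = unidiag U (realrow (fun k => f (d k))).
Proof.
move=> uU; have := unidiag_herm U (realrow_real d).
move=> /hermitian_normalmx/orthomx_spectralP.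
rewrite /mxfun; move: (spectral_unitarymx (unidiag U (realrow d))).
move: (spectralmx _) (spectral_diag _) => V e uV.
rewrite (invmx_unitary uV) -!/(unidiag _ _) => UV.
rewrite -(unidiag_map (fun z => (f (complex.Re z))%:C) uU uV UV).
suff -> : map_mx (fun z => (f (complex.Re z))%:C) (realrow d)
        = realrow (fun k => f (d k)) by [].
by apply/rowP => k; rewrite !mxE.
Qed.

Lemma possemidef_conj_diag U B k : possemidef B -> 0 <= (U *m B *m U^t*) k k.
Proof. by case=> _ pB; rewrite conj_diagE. Qed.

Lemma posdef_conj_diag U B k : U \in unitmx -> posdef B ->
  0 < (U *m B *m U^t*) k k.
Proof. by move=> uU [_ pB]; rewrite conj_diagE pB// row_trmxC_neq0. Qed.

Lemma posdef_possemidef B : posdef B -> possemidef B.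
Proof.
case=> hB pB; split=> // v; have [->|/pB/ltW//] := eqVneq v 0.
by rewrite mulmx0 mxE.
Qed.

Lemma posdef_congr T A : T \in unitmx -> posdef A -> posdef (T^t* *m A *m T).
Proof.
move=> uT [/hermsymmxP hA pA]; split.
  by apply/hermsymmxP; rewrite !trmxC_mul hA trmxCK mulmxA.
move=> v v0.
have -> : v^t* *m (T^t* *m A *m T) *m v = (T *m v)^t* *m A *m (T *m v).
  by rewrite trmxC_mul !mulmxA.
by apply: pA; apply: contra_neq v0 => Tv0; rewrite -(mulKmx uT v) Tv0 mulmx0.
Qed.

Lemma posdef_unidiag U d : U \is unitarymx -> (forall k, 0 < d k) ->
  posdef (unidiag U (realrow d)).
Proof.
move=> uU d0; apply: posdef_congr; first exact: unitarymx_unit.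
split=> [|v v0]; last by apply: diag_form_gt0 => // k; rewrite mxE ltcR.
by apply/hermsymmxP; rewrite tr_diag_mx map_diag_mx (realmxC (realrow_real d)).
Qed.

Lemma posdef_unidiagP A : posdef A ->
  exists U, exists2 d, U \is unitarymx /\ (forall k, 0 < d k)
                     & A = unidiag U (realrow d).
Proof.
move=> pA; have [hA _] := pA.
have uV := spectral_unitarymx A.
have /orthomx_spectralP := hermitian_normalmx hA.
rewrite (invmx_unitary uV) -/(unidiag _ _).
move: (spectralmx A) (spectral_diag A) uV => U d uU AE.
have d0 k : 0 < d 0 k.
  have := posdef_conj_diag k (unitarymx_unit uU) pA.
  by rewrite AE (unidiag_conj _ uU) mxE eqxx mulr1n.
have dE k : d 0 k = (complex.Re (d 0 k))%:C by rewrite RRe_real// gtr0_real.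
exists U, (fun k => complex.Re (d 0 k)).
  by split=> // k; have := d0 k; rewrite dE ltcR.
by rewrite AE; congr unidiag; apply/rowP => k; rewrite mxE.
Qed.

Lemma posdef_unit A : posdef A -> A \in unitmx.
Proof.
move=> /posdef_unidiagP[U [d [uU d0] ->]]; apply: (unidiag_unit uU) => k.
by rewrite mxE gt_eqF// ltcR.
Qed.

Lemma posdef_trmxC A : posdef A -> A^t* = A.
Proof. by case=> /hermsymmxP. Qed.

Lemma posdef_sandwich S A : posdef S -> posdef A -> posdef (S *m A *m S).
Proof.
move=> pS pA; rewrite -{1}(posdef_trmxC pS).
exact: posdef_congr (posdef_unit pS) pA.
Qed.

Lemma posdef_inv A : posdef A -> posdef (invmx A).
Proof.
move=> pA; have uA := posdef_unit pA.
have -> : invmx A = (invmx A)^t* *m A *m invmx A.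
  by rewrite trmxC_inv (posdef_trmxC pA) (mulVmx uA) mul1mx.
by apply: posdef_congr => //; rewrite unitmx_inv.
Qed.

Lemma posdefZ s A : 0 < s -> posdef A -> posdef (s%:C *: A).
Proof.
move=> s0 [/hermsymmxP hA pA]; split=> [|v /pA A0].
  apply/hermsymmxP; rewrite linearZ /= map_mxZ hA; congr (_ *: _).
  by apply: conj_Creal; rewrite complex_real.
by rewrite -scalemxAr -scalemxAl mxE mulr_gt0// ltcR.
Qed.

Lemma posdef1 : posdef (1%:M : 'M[R[i]]_n).
Proof.
have := @posdef_unidiag 1%:M (fun=> 1).
rewrite (_ : realrow _ = const_mx 1); last by apply/rowP => k; rewrite !mxE.
have u1 : (1%:M : 'M[R[i]]_n) \is unitarymx.
  by apply/unitarymxP; rewrite trmx1 map_mx1 mulmx1.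
by rewrite (unidiag1 u1); apply.
Qed.

Lemma posdef_mxtrace_ge0 A : posdef A -> 0 <= \tr A.
Proof.
move=> /posdef_possemidef pA; apply: sumr_ge0 => k _.
by have := possemidef_conj_diag 1%:M k pA; rewrite trmx1 map_mx1 mulmx1 mul1mx.
Qed.

(** Uniqueness of the positive square root: a diagonalization of [B] also
    diagonalizes [B *m B]. *)
Lemma sqrtmx_sqr B : posdef B -> sqrtmx (B *m B) = B.
Proof.
move=> /posdef_unidiagP[U [d [uU d0] ->]].
rewrite (unidiag_realrowM _ _ uU) /sqrtmx (mxfun_unidiag _ _ uU).
suff -> : (fun k => Num.sqrt (d k * d k)) = d by [].
by apply/funext => k; rewrite -expr2 sqrtr_sqr gtr0_norm.
Qed.

Lemma posdef_sqrtmx A : posdef A -> posdef (sqrtmx A).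
Proof.
move=> /posdef_unidiagP[U [d [uU d0] ->]].
rewrite /sqrtmx (mxfun_unidiag _ _ uU).
by apply: (posdef_unidiag uU) => k; rewrite sqrtr_gt0.
Qed.

Lemma sqrtmxK A : posdef A -> sqrtmx A *m sqrtmx A = A.
Proof.
move=> /posdef_unidiagP[U [d [uU d0] ->]].
rewrite /sqrtmx (mxfun_unidiag _ _ uU) (unidiag_realrowM _ _ uU).
suff -> : (fun k => Num.sqrt (d k) * Num.sqrt (d k)) = d by [].
by apply/funext => k; rewrite -expr2 sqr_sqrtr// ltW.
Qed.

Lemma sqrtmx1 : sqrtmx (1%:M : 'M[R[i]]_n) = 1%:M.
Proof. by rewrite -[in LHS](mulmx1 1%:M) (sqrtmx_sqr posdef1). Qed.

Lemma sqrtmxZ s A : 0 < s -> posdef A ->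
  sqrtmx ((s ^+ 2)%:C *: A) = s%:C *: sqrtmx A.
Proof.
move=> s0 pA; rewrite -[RHS]sqrtmx_sqr; last by apply/posdefZ/posdef_sqrtmx.
by rewrite -scalemxAl -scalemxAr scalerA (sqrtmxK pA) -rmorphM.
Qed.

Lemma ler_mxtrace_unidiag X U d e : possemidef X -> (forall k, d k <= e k) ->
  \tr (X *m unidiag U (realrow d)) <= \tr (X *m unidiag U (realrow e)).
Proof.
move=> pX de; apply: ler_mxtrace_mul_unidiag => k.
  exact: possemidef_conj_diag.
by rewrite [realrow d 0 k]mxE [realrow e 0 k]mxE lecR.
Qed.

(** The scalar bound [ln y <= y - 1] on the eigenvalues of [Y], weighted by the
    nonnegative diagonal of [X] in an eigenbasis of [Y]. *)
Lemma mxtrace_logmx_le X Y : posdef X -> posdef Y ->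
  \tr (X *m logmx Y) <= \tr (X *m Y) - \tr X.
Proof.
move=> /posdef_possemidef pX /posdef_unidiagP[U [d [uU d0] ->]].
rewrite -raddfB -[X in _ - X]mulmx1 -mulmxBr -(unidiag1 uU) unidiagB.
have -> : realrow d - const_mx 1 = realrow (fun k => d k - 1).
  by apply/rowP => k; rewrite !mxE rmorphB.
rewrite /logmx (mxfun_unidiag _ _ uU); apply: (ler_mxtrace_unidiag _ pX) => k.
have := @le_ln1Dx _ (d k - 1).
by rewrite [1 + _]addrC subrK; apply; rewrite ltrBDl subrr.
Qed.

Lemma mxtrace_cube_le X : posdef X -> loewner_le X 1%:M ->
  \tr (X *m X *m X) <= \tr X.
Proof.
move=> /posdef_unidiagP[U [d [uU d0] ->]] X1.
have d1 k : d k <= 1.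
  have := possemidef_conj_diag U k X1.
  rewrite -(unidiag1 uU) unidiagB (unidiag_conj _ uU) !mxE eqxx mulr1n.
  by rewrite -rmorphB ler0c subr_ge0.
rewrite !(unidiag_realrowM _ _ uU).
have d3 k : d k * d k * d k <= d k by have := d0 k; have := d1 k; nra.
(* the plain trace is the trace weighted by the identity matrix *)
have tr1 (M N : 'M[R[i]]_n) :
    \tr (1%:M *m M) <= \tr (1%:M *m N) -> \tr M <= \tr N.
  by rewrite !mul1mx.
exact: tr1 (ler_mxtrace_unidiag U (posdef_possemidef posdef1) d3).
Qed.

Lemma posdef_geomean A B : posdef A -> posdef B -> posdef (geomean A B).
Proof.
move=> pA pB; have pS := posdef_sqrtmx pA; have pS' := posdef_inv pS.
exact: posdef_sandwich pS (posdef_sqrtmx (posdef_sandwich pS' pB)).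
Qed.

(** With [S] the root of [A] and [T] that of [S^-1 B S^-1], one has
    [B = S T T S], so that everything cancels in
    [(S T S) (S^-1 T^-1 T^-1 S^-1) (S T S)] except [S S = A]. *)
Lemma geomean_riccati A B : posdef A -> posdef B ->
  geomean A B *m invmx B *m geomean A B = A.
Proof.
move=> pA pB; rewrite /geomean /=.
have pS := posdef_sqrtmx pA; have pS' := posdef_inv pS.
have pT := posdef_sandwich pS' pB.
have uS := posdef_unit pS; have uB := posdef_unit pB.
move: (sqrtmxK pA) (sqrtmxK pT) (posdef_unit (posdef_sqrtmx pT)).
move: (sqrtmx A) (sqrtmx (_ *m _ *m _)) uS => S T uS SA TT uT.
have BE : B = S *m T *m (T *m S).
  by rewrite mulmxA -(mulmxA S T) TT !mulmxA (mulmxV uS) mul1mx (mulmxKV uS).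
have EB : invmx S *m invmx T *m (invmx T *m invmx S) *m B = 1%:M.
  by rewrite BE !mulmxA (mulmxKV uS) (mulmxKV uT) (mulmxKV uT) (mulVmx uS).
rewrite -[invmx B]mul1mx -EB (mulmxK uB) !mulmxA.
by rewrite (mulmxK uS) (mulmxK uT) (mulmxKV uS) (mulmxKV uT).
Qed.

Definition fidelity X A : R[i] := \tr (sqrtmx (sqrtmx X *m A *m sqrtmx X)).

Lemma fidelity_ge0 X A : posdef X -> posdef A -> 0 <= fidelity X A.
Proof.
move=> pX pA; apply/posdef_mxtrace_ge0/posdef_sqrtmx.
exact: posdef_sandwich (posdef_sqrtmx pX) pA.
Qed.

Lemma fidelityZ s X A : 0 < s -> posdef X -> posdef A ->
  fidelity ((s ^+ 2)%:C *: X) A = s%:C * fidelity X A.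
Proof.
move=> s0 pX pA; rewrite /fidelity (sqrtmxZ s0 pX) -mxtraceZ; congr (\tr _).
rewrite -scalemxAr -!scalemxAl scalerA -rmorphM.
exact: sqrtmxZ s0 (posdef_sandwich (posdef_sqrtmx pX) pA).
Qed.

(** With [S] the root of [X], the matrix [S (Y X Y) S] is the square of the
    positive matrix [S Y S]. *)
Lemma fidelity_sandwich X Y : posdef X -> posdef Y ->
  fidelity X (Y *m X *m Y) = \tr (X *m Y).
Proof.
move=> pX pY; have pS := posdef_sqrtmx pX; rewrite /fidelity -(sqrtmxK pX).
move: (sqrtmx X) pS => S pS; rewrite (sqrtmx_sqr pS).
have -> : S *m (Y *m (S *m S) *m Y) *m S = (S *m Y *m S) *m (S *m Y *m S).
  by rewrite !mulmxA.
by rewrite (sqrtmx_sqr (posdef_sandwich pS pY)) mxtrace_mulC mulmxA.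
Qed.

End PositiveDefinite.

(** * Wasserstein mean and fidelity *)

Section Means.
Local Open Scope complex_scope.
Set Implicit Arguments.
Unset Strict Implicit.

Variables (R : realType) (n m : nat).
Variables (w : 'I_m -> R) (A : 'I_m -> 'M[R[i]]_n).
Hypotheses (w_weights : weights w) (A_posdef : forall i, posdef (A i)).
Implicit Types X Y W : 'M[R[i]]_n.

Definition mean_fidelity Y : R[i] := \sum_i (w i)%:C * fidelity Y (A i).

Let weight_ge0 i : 0 <= (w i)%:C.
Proof. by rewrite ler0c ltW//; case: w_weights. Qed.

Let sum_weights : \sum_i (w i)%:C = 1.
Proof.
by case: w_weights => _ w1; rewrite -(rmorph_sum (real_complex R)) w1.
Qed.

Lemma mean_fidelity_ge0 Y : posdef Y -> 0 <= mean_fidelity Y.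
Proof.
move=> pY; apply: sumr_ge0 => i _; apply: (mulr_ge0 (weight_ge0 i)).
exact: fidelity_ge0 pY (A_posdef i).
Qed.

Lemma mean_fidelityZ s Y : 0 < s -> posdef Y ->
  mean_fidelity ((s ^+ 2)%:C *: Y) = s%:C * mean_fidelity Y.
Proof.
move=> s0 pY; rewrite /mean_fidelity mulr_sumr; apply: eq_bigr => i _.
by rewrite (fidelityZ s0 pY (A_posdef i)) mulrCA.
Qed.

Lemma wasserstein_costE Y : wasserstein_cost w A Y =
  \tr Y - 2 * mean_fidelity Y + \sum_i (w i)%:C * \tr (A i).
Proof.
rewrite addrAC /wasserstein_cost /mean_fidelity.
rewrite -[\tr Y]mul1r -[X in X * \tr Y]sum_weights mulr_suml.
rewrite -big_split /= mulr_sumr -sumrB.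
apply: eq_bigr => i _; rewrite /dW sqrtCK linearB /=.
rewrite mxtraceD mxtraceZ -/(fidelity _ _).
rewrite mulrBr mulrDr; congr (_ - _); exact: mulrCA.
Qed.

(** The first-order condition at [s = 1] of a minimum of
    [s ^+ 2 * a - 2 * (s * b)], obtained without derivatives. *)
Lemma scaling_stationary (a b : R) : 0 <= a ->
  (forall s, 0 < s -> a - 2 * b <= s ^+ 2 * a - 2 * (s * b)) -> b <= a.
Proof.
move=> a0 min; rewrite leNgt; apply/negP => ab.
have [a_eq0|a_neq0] := eqVneq a 0.
  by have := min 2 (ltr0n _ _); rewrite a_eq0; lra.
have a_gt0 : 0 < a by rewrite lt_neqAle eq_sym a_neq0.
(* the vertex of the parabola, where its value is - b ^+ 2 / a *)
have := min (b / a) (divr_gt0 (lt_trans a_gt0 ab) a_gt0).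
have -> : (b / a) ^+ 2 * a - 2 * (b / a * b) = - (b ^+ 2 / a) by field.
rewrite lerNr opprB ler_pdivrMr//; nra.
Qed.

(** Minimality of [W] among its own multiples [s ^+ 2 *: W]. *)
Lemma mean_fidelity_le_mxtrace W : is_wasserstein_mean w A W ->
  mean_fidelity W <= \tr W.
Proof.
move=> [pW minW].
have aE := RRe_real (ger0_real (posdef_mxtrace_ge0 pW)).
have bE := RRe_real (ger0_real (mean_fidelity_ge0 pW)).
rewrite -aE -bE lecR; apply: scaling_stationary.
  by rewrite -ler0c aE posdef_mxtrace_ge0.
move=> s s0; have := minW _ (posdefZ (exprn_gt0 2 s0) pW).
rewrite !wasserstein_costE (mean_fidelityZ s0 pW) mxtraceZ.
rewrite lerD2r -aE -bE.
by rewrite -lecR !(rmorphB, rmorphM, rmorph_nat).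
Qed.

Lemma le_of_dual_gap (C : numDomainType) (a b c d : C) :
  a - 2 * b <= c - 2 * d -> b <= a -> 2 * d - c <= a.
Proof.
move=> gap ba; rewrite -subr_ge0.
have -> : a - (2 * d - c) = (c - 2 * d - (a - 2 * b)) + 2 * (a - b) by ring.
by rewrite addr_ge0 ?mulr_ge0 ?subr_ge0.
Qed.

(** A variational characterization from below: equality holds at [Y = W], so
    bounding [\tr W] from below amounts to choosing a good [Y]. *)
Lemma mxtrace_mean_ge W Y : is_wasserstein_mean w A W -> posdef Y ->
  2 * mean_fidelity Y - \tr Y <= \tr W.
Proof.
move=> hW pY; have [_ /(_ _ pY) +] := hW.
rewrite (wasserstein_costE W) (wasserstein_costE Y) lerD2r => WY.
exact: le_of_dual_gap WY (mean_fidelity_le_mxtrace hW).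
Qed.

(** Pairing the Karcher equation [\sum_i w_i log G_i = 0] with [X] and
    using [log G_i <= G_i - 1]; the Riccati equation identifies [\tr (X G_i)] with a
    fidelity. *)
Lemma Gamma_mean_fidelity X : Gamma w A X -> \tr X <= mean_fidelity X.
Proof.
move=> [pX [_]]; rewrite sqrtmx1 invmx1.
set G := fun i => geomean (A i) (invmx X) => logG0.
have pG i : posdef (G i) := posdef_geomean (A_posdef i) (posdef_inv pX).
have AE i : A i = G i *m X *m G i.
  have := geomean_riccati (A_posdef i) (posdef_inv pX).
  by rewrite invmxK => {1}<-.
have : \sum_i (w i)%:C * \tr (X *m logmx (G i)) = 0.
  rewrite -[RHS](mxtrace0 _ n) -[0 in RHS](mulmx0 _ X) -logG0 mulmx_sumr.
  rewrite raddf_sum /=; apply: eq_bigr => i _.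
  by rewrite -scalemxAr mxtraceZ mul1mx mulmx1.
have -> : mean_fidelity X = \sum_i (w i)%:C * \tr (X *m G i).
  apply: eq_bigr => i _; congr (_ * _).
  by rewrite [A i]AE (fidelity_sandwich pX (pG i)).
have trX : \tr X = \sum_i (w i)%:C * \tr X.
  by rewrite -mulr_suml sum_weights mul1r.
move=> log0; rewrite [leLHS]trX -subr_ge0 -sumrB -[leLHS]log0.
apply: ler_sum => i _; rewrite -mulrBr.
exact: (ler_wpM2l (weight_ge0 i) (mxtrace_logmx_le pX (pG i))).
Qed.

End Means.

Theorem proposition3p9 (R : realType) (n m : nat)
    (w : 'I_m -> R) (A : 'I_m -> 'M[R[i]]_n) (X W : 'M[R[i]]_n)
    (hw : weights w) (hA : forall i, posdef (A i))
    (hX : Gamma w A X) (hX1 : loewner_le X 1%:M)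
    (hW : is_wasserstein_mean w A W) :
  \tr (X ^+ 3) <= \tr W.
Proof.
have [pX _] := hX.
have X3 : \tr (X ^+ 3) <= \tr X.
  rewrite !exprS expr0 mulr1 mulrA; exact: mxtrace_cube_le.
apply: (le_trans X3); apply: le_trans (mxtrace_mean_ge hw hA hW pX).
rewrite lerBrDr -mulr2n -[leLHS]mulr_natl ler_wpM2l//.
exact: Gamma_mean_fidelity.
Qed.
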